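(* Let $a\in\mathbb{C}$ and let $f$ be a function with the Laurent expansion $$f(z)=\sum_{k=-\infty}^{\infty}a_k(z-a)^k$$ valid on the whole complex plane except at $z=a$. If there exist two numbers $\alpha>0$ and $0<q<1$ such that $$c=\sum_{k=-\infty}^{\infty}|a_k|\,q^{-|k|^{\alpha+1}}<\infty,$$ then for all $z\ne a$, $$|f(z)|\le c\,\exp\left\{\beta\,\bigl|\log|z-a|\bigr|^{\gamma}\right\},$$ where $$\beta=\frac{\alpha}{(\alpha+1)^{1+1/\alpha}\,(\log q^{-1})^{1/\alpha}},\qquad \gamma=\frac{\alpha+1}{\alpha}.$$ In particular, for every $0<q<1$, every $0<\alpha<1$ and every nonzero complex number $z$, the theta function $\Theta(z|q)$ satisfies $$|\Theta(z|q)|\le c_\alpha\left[\exp\left(\frac{\bigl|\log|z|\bigr|^2}{\log q^{-1}}\right)\right]^{1/\alpha},\qquad\text{where } c_\alpha=\sum_{k=-\infty}^{\infty}q^{k^2-|k|^{1+\alpha}}.$$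
   Context: The theta function is $\Theta(z|q)=\sum_{k=-\infty}^{\infty}q^{k^2}z^k$ for $0<q<1$ and nonzero complex $z$. *)

(* Defs.v *)
From mathcomp Require Import all_boot all_order all_algebra.
From mathcomp Require Import all_classical all_reals all_analysis.
From mathcomp Require Import complex.
Set Implicit Arguments.
Unset Strict Implicit.
Unset Printing Implicit Defensive.
Import Order.TTheory GRing.Theory Num.Theory.
Import numFieldNormedType.Exports.
Local Open Scope classical_set_scope.
Local Open Scope ring_scope.

(* The modulus of a complex number, as an element of [R] (the library's
   [`|z|] on [R[i]] is valued in [R[i]]). *)
Notation normc := ComplexField.Normc.normc.

(* [R[i]] carries no topology in the libraries; convergence of a complex series
   is convergence to 0 of the modulus of the error of the partial sums. *)
Definition has_csum (R : realType) (u : nat -> R[i]) (l : R[i]) : Prop :=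
  normc (l - series u n) @[n --> \oo] --> (0 : R).

(* A bilateral series converges when its parts over [k >= 0] and [k < 0] both
   do; recall that [Negz n] is the integer [- n.+1]. *)
Definition has_bisum (R : realType) (u : int -> R[i]) (l : R[i]) : Prop :=
  exists l1 l2 : R[i],
    [/\ has_csum (fun n => u (Posz n)) l1,
        has_csum (fun n => u (Negz n)) l2 & l = l1 + l2].

Definition theta_term (R : realType) (q : R) (z : R[i]) (k : int) : R[i] :=
  (q ^ (k ^+ 2))%:C%C * z ^ k.

Definition theta (R : realType) (z : R[i]) (q : R) : R[i] :=
  xget 0 [set l | has_bisum (theta_term q z) l].

(* The value [theta z q] is meaningful: the defining series converges
   ([has_bisum_theta]) to a unique limit ([has_bisum_unique]). *)

Lemma ler_normcD (R : rcfType) (x y : R[i]) : normc (x + y) <= normc x + normc y.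
Proof. exact: le_normcD. Qed.

Lemma normc_opp (R : rcfType) (x : R[i]) : normc (- x) = normc x.
Proof. exact: normcN. Qed.

Lemma normc_ge0 (R : rcfType) (x : R[i]) : 0 <= normc x.
Proof. by case: x => a b; rewrite /= sqrtr_ge0. Qed.

Lemma has_csum_unique (R : realType) (u : nat -> R[i]) (l l' : R[i]) :
  has_csum u l -> has_csum u l' -> l = l'.
Proof.
move=> ul ul'; apply/eqP; rewrite -subr_eq0; apply/eqP.
apply: ComplexField.Normc.eq0_normc; apply/eqP.
rewrite eq_le normc_ge0 andbT.
have h : normc (l - series u n) + normc (l' - series u n) @[n --> \oo]
    --> (0 + 0 : R) by apply: cvgD.
rewrite addr0 in h; apply: (cvgr_to_ge h).
near=> n; rewrite -(normc_opp (l' - _)) (le_trans _ (ler_normcD _ _)) //.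
by rewrite opprB addrA subrK.
Unshelve. all: by end_near. Qed.

Lemma has_bisum_unique (R : realType) (u : int -> R[i]) (l l' : R[i]) :
  has_bisum u l -> has_bisum u l' -> l = l'.
Proof.
move=> [l1 [l2 [h1 h2 ->]]] [l1' [l2' [h1' h2' ->]]].
by rewrite (has_csum_unique h1 h1') (has_csum_unique h2 h2').
Qed.

Lemma has_csum_normc (R : realType) (u : nat -> R[i]) :
  cvgn (series (fun n => normc (u n))) -> exists l, has_csum u l.
Proof.
move=> cu.
have leRI (x : R[i]) : `|complex.Re x| <= normc x /\ `|complex.Im x| <= normc x.
  by case: x => a b /=; rewrite -!sqrtr_sqr !ler_sqrt ?addr_ge0 ?sqr_ge0//
    lerDl lerDr !sqr_ge0.
have cRe : cvgn (series (fun n => complex.Re (u n))).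
  apply: normed_cvg; apply: series_le_cvg cu => n //=; first exact: normc_ge0.
  exact: (leRI _).1.
have cIm : cvgn (series (fun n => complex.Im (u n))).
  apply: normed_cvg; apply: series_le_cvg cu => n //=; first exact: normc_ge0.
  exact: (leRI _).2.
set x := limn _ in cRe; set y := limn _ in cIm.
exists (x +i* y)%C; rewrite /has_csum.
have normc_le (z : R[i]) : normc z <= `|complex.Re z| + `|complex.Im z|.
  case: z => a b /=; rewrite -[leRHS]ger0_norm ?addr_ge0// -sqrtr_sqr.
  rewrite ler_sqrt ?sqr_ge0// sqrrD !real_normK ?num_real//.
  by rewrite addrAC lerDl mulrn_wge0 ?mulr_ge0.
apply: (@squeeze_cvgr _ _ _ _ (fun=> 0) (fun n =>
    `|x - series (fun n => complex.Re (u n)) n| +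
    `|y - series (fun n => complex.Im (u n)) n|)); last 2 first.
- exact: cvg_cst.
- rewrite -[X in _ --> X]addr0; apply: cvgD.
    by apply/norm_cvg0P; rewrite -(subrr x); apply: cvgB => //; exact: cvg_cst.
  by apply/norm_cvg0P; rewrite -(subrr y); apply: cvgB => //; exact: cvg_cst.
near=> n; rewrite normc_ge0 (le_trans (normc_le _))//=.
have ReD (w v : R[i]) : complex.Re (w + v) = complex.Re w + complex.Re v.
  by case: w; case: v.
have ImD (w v : R[i]) : complex.Im (w + v) = complex.Im w + complex.Im v.
  by case: w; case: v.
have ReN (w : R[i]) : complex.Re (- w) = - complex.Re w by case: w.
have ImN (w : R[i]) : complex.Im (- w) = - complex.Im w by case: w.
by rewrite /series /= ReD ImD ReN ImN (big_morph _ ReD (erefl _))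
  (big_morph _ ImD (erefl _)).
Unshelve. all: by end_near. Qed.

Lemma cvg_series_sqr (R : realType) (q r : R) (s : nat) :
  0 < q < 1 -> 0 <= r ->
  cvgn (series (fun n => q ^+ ((n + s) ^ 2)%N * r ^+ (n + s)%N)).
Proof.
move=> /andP[q0 q1] r0; pose b n : R := (q ^+ n * (2 * r)) ^+ n.
have qr0 n : 0 <= q ^+ n * (2 * r).
  by apply: mulr_ge0; [exact/exprn_ge0/ltW | exact: mulr_ge0].
have b0 n : 0 <= b n by exact: exprn_ge0.
have [N _ bN] : \forall n \near \oo, q ^+ n * (2 * r) <= 1.
  have h : q ^+ n * (2 * r) @[n --> \oo] --> (0 * (2 * r) : R).
    by apply: cvgMl; apply: cvg_expr; rewrite ger0_norm ?ltW.
  by rewrite mul0r in h; apply: (cvgr_le _ h); rewrite ltr01.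
pose M := 1 + \sum_(i < N) b i.
have M0 : 0 <= M by rewrite addr_ge0 ?sumr_ge0.
have bM n : b n <= M.
  have [nN|Nn] := ltnP n N.
    rewrite /M (bigD1 (Ordinal nN)) //= addrCA lerDl addr_ge0 ?sumr_ge0//.
  rewrite (@le_trans _ _ 1)// ?lerDl ?sumr_ge0//.
  by rewrite exprn_ile1 ?bN.
apply: (@series_le_cvg _ _ (geometric M 2^-1)) => [n|n|n|].
- by rewrite mulr_ge0// exprn_ge0// ltW.
- by rewrite /= mulr_ge0 ?exprn_ge0.
- have -> : q ^+ ((n + s) ^ 2)%N * r ^+ (n + s)%N = b (n + s)%N * 2^-1 ^+ (n + s).
    rewrite /b -exprMn -mulrA mulrAC mulfV// mul1r exprMn -exprM.
    by rewrite mulnn.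
  rewrite /= ler_pM ?exprn_ge0// exprD ler_piMr ?exprn_ge0//.
  by rewrite exprn_ile1// invf_le1// ler1n.
- by apply: is_cvg_geometric_series; rewrite ger0_norm// invf_lt1// ltr1n.
Qed.

Lemma has_bisum_theta (R : realType) (q : R) (z : R[i]) :
  0 < q < 1 -> z != 0 -> has_bisum (theta_term q z) (theta z q).
Proof.
move=> q01 z0; apply: xgetPex.
have normcX (x : R[i]) n : normc (x ^+ n) = normc x ^+ n.
  elim: n => [|n IHn]; first by rewrite !expr0 ComplexField.Normc.normc1.
  by rewrite !exprS ComplexField.Normc.normcM IHn.
have normcR (x : R) : 0 <= x -> normc x%:C%C = x.
  by move=> x0; rewrite /= expr0n addr0 sqrtr_sqr ger0_norm.
have q0 : 0 <= q by case/andP: q01 => /ltW.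
have [l1 h1] : exists l, has_csum (fun n => theta_term q z (Posz n)) l.
  apply: has_csum_normc.
  rewrite (_ : (fun n => _) =
      fun n => q ^+ ((n + 0) ^ 2)%N * normc z ^+ (n + 0)).
    by apply: cvg_series_sqr; rewrite ?normc_ge0.
  apply/funext => n; rewrite addn0 /theta_term ComplexField.Normc.normcM.
  by rewrite -exprnP normcX normcR ?exprz_ge0.
have [l2 h2] : exists l, has_csum (fun n => theta_term q z (Negz n)) l.
  apply: has_csum_normc.
  rewrite (_ : (fun n => _) =
      fun n => q ^+ ((n + 1) ^ 2)%N * (normc z)^-1 ^+ (n + 1)).
    by apply: cvg_series_sqr; rewrite ?invr_ge0 ?normc_ge0.
  apply/funext => n; rewrite addn1 /theta_term ComplexField.Normc.normcM.
  rewrite normcR ?exprz_ge0// NegzE sqrrN.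
  by rewrite -exprnN -exprVn normcX ComplexField.Normc.normcV.
by exists (l1 + l2), l1, l2.
Qed.

(* Main.v *)
Require Import Defs.
From mathcomp Require Import all_boot all_order all_algebra.
From mathcomp Require Import all_classical all_reals all_analysis.
From mathcomp Require Import complex.
From mathcomp Require Import ring lra.
Import Order.TTheory GRing.Theory Num.Theory.
Import numFieldNormedType.Exports.
Local Open Scope classical_set_scope.
Local Open Scope ring_scope.

(** Both bounds come from the triangle inequality over the bilateral series,
    followed by a bound of each term by [M * t k], where the [t k] sum to the
    constant of the statement and [M] does not depend on [k]
    ([bisum_le_shift]).

    Write [l = ln q^-1 > 0].  For the Laurent series, [w = z - a] and
    [L = ln |w|], the [k]-th term has modulus [|a_k| * exp (k L)], and Young's
    inequality with the conjugate exponents [alpha + 1] and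
    [gamma = (alpha + 1) / alpha] gives
    [k L <= |k| |L| <= l |k|^(alpha + 1) + beta |L|^gamma];
    the constant [beta] is exactly the one that Young's inequality produces
    once the first summand is normalised to have coefficient [l]
    ([young_scaled]).

    For the theta function with [alpha < 1] the exponent [gamma] exceeds 2, so
    specialising the first bound gives too fast a growth for large [L].
    Instead, complete the square: [q^(k^2) exp (k L)] equals
    [exp (L^2 / (4 l)) * q^((k - y)^2)] with [y = L / (2 l)].  Let [n] be an
    integer nearest to [y] and shift the summation index by [n].  Then
    [y = n + r] with [|r| <= 1/2], and
    [(k - r)^2 >= k^2 - |k| >= k^2 - |k|^(1 + alpha)] because [k] is an integer.
    Thus the remaining sum is at most [c_alpha], which gives the bound with
    [1/4] in place of [1/alpha] ([theta_growth]).  It also has to be known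
    that [c_alpha] is finite: by Young's inequality its exponent is at least
    [s k^2 - s] with [s = (1 - alpha) / 2 > 0]
    ([esum_theta_weight_lt_pinfty]). *)

(** * Bilateral sums *)

Lemma esum_int (R : realType) (a : int -> \bar R) :
  (forall k, (0 <= a k)%E) ->
  \esum_(k in [set: int]) a k =
  (\sum_(0 <= n <oo) a (Posz n) + \sum_(0 <= n <oo) a (Negz n))%E.
Proof.
move=> a0; rewrite !nneseries_esumT//.
have Posz_inj : set_inj [set: nat] Posz by move=> m n _ _ [].
have Negz_inj : set_inj [set: nat] Negz by move=> m n _ _ [].
rewrite (esumID (range Posz))// !setTI.
have -> : ~` range Posz = range Negz.
  apply/seteqP; split=> [[n|n]|_ [n _ <-]]; [|by exists n|by case].
  by move=> /(_ (ex_intro2 _ _ n I erefl)).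
by rewrite !esum_image.
Qed.

Lemma esum_intZl (R : realType) (c : R) (a : int -> \bar R) :
  (forall k, (0 <= a k)%E) -> 0 <= c ->
  \esum_(k in [set: int]) (c%:E * a k)%E =
  (c%:E * \esum_(k in [set: int]) a k)%E.
Proof.
move=> a0 c0; rewrite !esum_int// => [|k]; last by rewrite mule_ge0.
by rewrite ge0_muleDr ?nneseries_ge0// !nneseriesZl.
Qed.

(** * Moduli and real powers as exponentials *)

Lemma normcXz (R : realType) (z : R[i]) (k : int) :
  normc (z ^ k) = normc z ^ k.
Proof.
have normcX n : normc (z ^+ n) = normc z ^+ n.
  elim: n => [|n IHn]; first by rewrite !expr0 ComplexField.Normc.normc1.
  by rewrite !exprS ComplexField.Normc.normcM IHn.
case: k => n; first exact: normcX.
by rewrite !NegzE -!exprnN ComplexField.Normc.normcV normcX.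
Qed.

Lemma normc_gt0 (R : realType) (z : R[i]) : z != 0 -> 0 < normc z.
Proof.
move=> z0; rewrite lt_neqAle normc_ge0 andbT eq_sym.
by apply: contra z0 => /eqP/ComplexField.Normc.eq0_normc ->.
Qed.

Lemma normcXzE (R : realType) (z : R[i]) (k : int) :
  z != 0 -> normc (z ^ k) = expR (k%:~R * ln (normc z)).
Proof.
move=> /normc_gt0 z0.
by rewrite normcXz -powR_intmul ?ltW// /powR gt_eqF.
Qed.

Lemma powRE (R : realType) (q x : R) : 0 < q -> q `^ x = expR (- x * ln q^-1).
Proof. by move=> q0; rewrite /powR gt_eqF// lnV ?posrE// mulrNN. Qed.

(** * The triangle inequality for bilateral series *)

Lemma normc_csum_le (R : realType) (u : nat -> R[i]) (l : R[i]) :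
  has_csum u l -> ((normc l)%:E <= \sum_(0 <= n <oo) (normc (u n))%:E)%E.
Proof.
move=> ul.
have u0 n : (0 <= n)%N -> true -> (0 <= (normc (u n))%:E)%E.
  by rewrite lee_fin normc_ge0.
apply/lee_addgt0Pr => e e0.
have [N _ /(_ N (leqnn N))/= leN] := cvgr_le _ ul e e0.
rewrite addeC (@le_trans _ _ (e%:E + \sum_(0 <= n < N) (normc (u n))%:E)%E)//.
  rewrite sumEFin -EFinD lee_fin.
  rewrite -[l in leLHS](subrK (series u N)) (le_trans (ler_normcD _ _))//.
  rewrite lerD// /series/=.
  apply: (big_ind2 (fun x y => normc x <= y)) => [|x y x' y' hx hy|n _ //].
    by rewrite ComplexField.Normc.normc0.
  by rewrite (le_trans (ler_normcD _ _))// lerD.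
by rewrite leeD2l// nneseries_lim_ge.
Qed.

Lemma normc_bisum_le (R : realType) (u : int -> R[i]) (l : R[i]) :
  has_bisum u l -> ((normc l)%:E <= \esum_(k in [set: int]) (normc (u k))%:E)%E.
Proof.
move=> [l1 [l2 [ul1 ul2 ->]]].
rewrite esum_int => [|k]; last by rewrite lee_fin normc_ge0.
apply: (le_trans _ (leeD (normc_csum_le _ _ _ ul1) (normc_csum_le _ _ _ ul2))).
by rewrite -EFinD lee_fin ler_normcD.
Qed.

(** The sum of the moduli is taken over all of the integers at once, hence may
    be reindexed by a translation; the two halves [k >= 0] and [k < 0] that
    define convergence are not preserved by it. *)
Lemma bisum_le_shift (R : realType) (u : int -> R[i]) (l : R[i]) (t : int -> R)
    (M : R) (n : int) :
  has_bisum u l -> 0 <= M -> (forall k, 0 <= t k) ->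
  (forall k, normc (u (k + n)) <= M * t k) ->
  (\esum_(k in [set: int]) (t k)%:E < +oo)%E ->
  normc l <= fine (\esum_(k in [set: int]) (t k)%:E) * M.
Proof.
move=> ul M0 t0 ut too.
have et0 : (0 <= \esum_(k in [set: int]) (t k)%:E)%E
  by apply: esum_ge0 => k _; rewrite lee_fin.
rewrite mulrC -lee_fin EFinM fineK ?ge0_fin_numE//.
rewrite -esum_intZl//; apply: (le_trans (normc_bisum_le _ _ _ ul)).
rewrite (reindex_esum [set: int] _ (fun k => k + n)).
  by apply: le_esum => k _; rewrite -EFinM lee_fin.
split=> [//|j k _ _ /addIr//|k _ /=].
by exists (k - n) => //; rewrite subrK.
Qed.

(** * Growth of Laurent series *)

(** Young's inequality applied to [(x c) (y / c)], where [c] is chosen so that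
    [c^(alpha + 1) / (alpha + 1) = b]. *)
Lemma young_scaled (R : realType) (alpha b x y : R) :
  0 < alpha -> 0 < b -> 0 <= x -> 0 <= y ->
  x * y <= b * x `^ (alpha + 1) +
    alpha / ((alpha + 1) `^ (1 + alpha^-1) * b `^ alpha^-1) *
      y `^ ((alpha + 1) / alpha).
Proof.
move=> a0 b0 x0 y0.
have p0 : 0 < alpha + 1 by rewrite addr_gt0.
have a1 : alpha != 0 by rewrite gt_eqF.
have p1 : alpha + 1 != 0 by rewrite gt_eqF.
pose c := ((alpha + 1) * b) `^ (alpha + 1)^-1.
have c0 : 0 < c by rewrite powR_gt0// mulr_gt0.
have -> : x * y = (x * c) * (y / c).
  by rewrite mulrACA mulfV ?mulr1// gt_eqF.
have pq : (alpha + 1)^-1 + ((alpha + 1) / alpha)^-1 = 1.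
  by field; rewrite p1 a1.
have := conjugate_powR (mulr_ge0 x0 (ltW c0)) (divr_ge0 y0 (ltW c0))
  p0 (divr_gt0 p0 a0) pq.
move=> /le_trans; apply.
have cp : c `^ (alpha + 1) = (alpha + 1) * b.
  by rewrite -powRrM mulVf// powRr1// mulr_ge0// ltW.
have cg : c `^ ((alpha + 1) / alpha) =
    (alpha + 1) `^ alpha^-1 * b `^ alpha^-1.
  by rewrite powRrM cp powRM// ltW.
rewrite lerD//.
  rewrite (powRM _ x0 (ltW c0)) cp [leLHS](_ : _ = b * x `^ (alpha + 1))//.
  by field.
rewrite powRM ?invr_ge0 ?(ltW c0)// -(powR_inv1 (ltW c0)) -powRrM mulN1r powRN cg.
rewrite powRD; last by rewrite p1 implybT.
rewrite (powRr1 (ltW p0)).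
set A := (alpha + 1) `^ _; set B := b `^ _.
have A0 : A != 0 by rewrite gt_eqF// powR_gt0.
have B0 : B != 0 by rewrite gt_eqF// powR_gt0.
rewrite [leLHS](_ : _ = alpha / ((alpha + 1) * A * B) *
  y `^ ((alpha + 1) / alpha))//.
by field; rewrite a1 p1 A0 B0.
Qed.

Lemma laurent_growth (R : realType) (u : int -> R[i]) (w l : R[i])
    (alpha q : R) :
  has_bisum (fun k => u k * w ^ k) l -> w != 0 -> 0 < alpha -> 0 < q < 1 ->
  let c : \bar R := \esum_(k in [set: int])
    (normc (u k) * q `^ (- (`|k%:~R| `^ (alpha + 1))))%:E in
  (c < +oo)%E ->
  normc l <= fine c * expR (alpha /
    ((alpha + 1) `^ (1 + alpha^-1) * (ln q^-1) `^ alpha^-1) *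
      `|ln (normc w)| `^ ((alpha + 1) / alpha)).
Proof.
move=> ul w0 a0 /andP[q0 q1] c coo.
have lq0 : 0 < ln q^-1 by rewrite ln_gt0// invf_gt1.
apply: (bisum_le_shift _ _ _ _ _ 0 ul) => // k; rewrite ?expR_ge0//.
  by rewrite mulr_ge0 ?normc_ge0 ?powR_ge0.
rewrite addr0 ComplexField.Normc.normcM normcXzE// mulrCA.
rewrite ler_wpM2l ?normc_ge0// (powRE _ q)// opprK -expRD ler_expR.
apply: (le_trans (ler_norm _)); rewrite normrM addrC [_ * ln q^-1]mulrC.
exact: young_scaled.
Qed.

(** * Growth of the theta function *)

(** For a real number [x] the inequality [|x| <= |x|^p] fails when [p > 1] and
    [0 < |x| < 1]; no integer lies in that range. *)
Lemma norm_int_le_powR (R : realType) (k : int) (p : R) :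
  1 <= p -> `|k%:~R| <= `|k%:~R : R| `^ p.
Proof.
move=> p1; have [->|k0] := eqVneq k 0.
  by rewrite normr0 powR_ge0.
by rewrite le1r_powR// -intr_norm ler1z -gtz0_ge1 normr_gt0.
Qed.

Lemma esum_gauss_lt_pinfty (R : realType) (q : R) :
  0 < q < 1 -> (\esum_(k in [set: int]) (q ^+ (`|k| ^ 2)%N)%:E < +oo)%E.
Proof.
move=> q01; have q0 : 0 <= q by case/andP: q01 => /ltW.
have term0 k : (0 <= (q ^+ (`|k : int| ^ 2)%N)%:E)%E by rewrite lee_fin exprn_ge0.
have half s : (\sum_(0 <= n <oo) (q ^+ ((n + s) ^ 2)%N)%:E < +oo)%E.
  have := @cvg_series_sqr _ q 1 s q01 ler01.
  under [X in series X]eq_fun do rewrite expr1n mulr1.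
  move=> cv; rewrite [X in limn X](_ : _ = EFin \o
      series (fun n => q ^+ ((n + s) ^ 2)%N)).
    by rewrite EFin_lim// ltry.
  by apply/funext => n; rewrite /= sumEFin.
rewrite esum_int// lte_add_pinfty//.
  by have := half 0%N; under eq_eseriesr do rewrite addn0.
by have := half 1%N; under eq_eseriesr do rewrite addn1.
Qed.

(** The term of exponent [k^2 - |k|^(1 + alpha)] is compared with a multiple of
    the Gaussian term [Q^(k^2)], [Q = q^((1 - alpha) / 2)]. *)
Lemma esum_theta_weight_lt_pinfty (R : realType) (q alpha : R) :
  0 < q < 1 -> 0 < alpha < 1 ->
  (\esum_(k in [set: int])
     (q `^ (k%:~R ^+ 2 - `|k%:~R| `^ (1 + alpha)))%:E < +oo)%E.
Proof.
move=> /andP[q0 q1] /andP[a0 a1].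
have lq0 : 0 < ln q^-1 by rewrite ln_gt0// invf_gt1.
pose s := (1 - alpha) / 2.
have s0 : 0 < s by rewrite divr_gt0// subr_gt0.
pose Q := q `^ s.
have Q01 : 0 < Q < 1.
  by rewrite /Q powR_gt0//= powRE// expR_lt1 mulNr oppr_lt0 mulr_gt0.
(* Young's inequality for the product [x^(1 + alpha) * 1], with exponents
   [2 / (1 + alpha)] and [1 / s]. *)
have young (x : R) : 0 <= x -> x `^ (1 + alpha) <= x ^+ 2 * (1 - s) + s.
  move=> x0.
  have p0 : 0 < 1 + alpha by rewrite addr_gt0.
  have := @conjugate_powR _ (x `^ (1 + alpha)) 1 (2 / (1 + alpha)) s^-1
    (powR_ge0 _ _) ler01.
  rewrite mulr1 powR1 divr_gt0// invr_gt0 -powRrM.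
  have -> : (2 / (1 + alpha))^-1 + s^-1^-1 = 1.
    by rewrite /s invrK; field; rewrite gt_eqF.
  have -> : (1 + alpha) * (2 / (1 + alpha)) = 2%:R by field; rewrite gt_eqF.
  rewrite powR_mulrn// invrK mul1r => /(_ erefl s0 erefl).
  by congr (_ <= _ * _ + _); rewrite /s; field; rewrite gt_eqF.
have bound (k : int) : q `^ (k%:~R ^+ 2 - `|k%:~R| `^ (1 + alpha)) <=
    q `^ (- s) * Q ^+ (`|k| ^ 2)%N.
  rewrite -powR_mulrn ?powR_ge0// -powRrM -powRD ?(gt_eqF q0) ?implybT//.
  rewrite !(powRE _ q)// ler_expR !mulNr lerN2 ler_pM2r//.
  have := young `|k%:~R| (normr_ge0 _).
  rewrite natrX natr_absz intr_norm real_normK ?num_real//.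
  lra.
have c0 : 0 <= q `^ (- s) by exact: powR_ge0.
have le_c : (\esum_(k in [set: int])
      (q `^ (k%:~R ^+ 2 - `|k%:~R| `^ (1 + alpha)))%:E <=
    \esum_(k in [set: int]) ((q `^ (- s))%:E * (Q ^+ (`|k| ^ 2)%N)%:E)%E)%E.
  by apply: le_esum => k _; rewrite -EFinM lee_fin.
apply: (le_lt_trans le_c).
rewrite esum_intZl// => [|k]; last first.
  by rewrite lee_fin exprn_ge0// ltW//; case/andP: Q01.
rewrite lte_mul_pinfty// esum_gauss_lt_pinfty//.
Qed.

(** The square is completed around [y = ln |z| / (2 ln q^-1)] and the sum is
    recentred at the integer nearest to [y], so that only the offset [r],
    [|r| <= 1/2], is left to be absorbed by the weight [|k|^(1 + alpha)]. *)
Lemma theta_growth (R : realType) (q alpha : R) (z : R[i]) :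
  0 < q < 1 -> 0 < alpha < 1 -> z != 0 ->
  normc (theta z q) <= fine (\esum_(k in [set: int])
      (q `^ (k%:~R ^+ 2 - `|k%:~R| `^ (1 + alpha)))%:E) *
    expR (`|ln (normc z)| ^+ 2 / (4 * ln q^-1)).
Proof.
move=> q01 a01 z0; have /andP[q0 q1] := q01; have /andP[a0 a1] := a01.
have lq0 : 0 < ln q^-1 by rewrite ln_gt0// invf_gt1.
pose y := ln (normc z) / (2 * ln q^-1).
pose n := Num.floor (y + 2^-1).
apply: (bisum_le_shift _ _ _ _ _ n (has_bisum_theta q01 z0)) => [|k|k|].
- exact: expR_ge0.
- exact: powR_ge0.
- rewrite ComplexField.Normc.normcM normcXzE// /theta_term.
  have -> : normc (q ^ ((k + n) ^+ 2))%:C%C = q `^ ((k + n) ^+ 2)%:~R.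
    rewrite /= expr0n addr0 sqrtr_sqr ger0_norm ?exprz_ge0 ?ltW//.
    by rewrite powR_intmul ?ltW.
  rewrite !(powRE _ q)// -!expRD ler_expR.
  have kp : `|k%:~R| <= `|k%:~R : R| `^ (1 + alpha).
    by apply: norm_int_le_powR; rewrite lerDl ltW.
  set p := _ `^ _ in kp *.
  pose r := y - n%:~R.
  have r_le : `|r| <= 2^-1.
    have := Num.Theory.floor_itv (y + 2^-1); rewrite -/n intrD /r => /andP[].
    rewrite ler_norml; move=> *; apply/andP; split; lra.
  have kr : k%:~R * r *+ 2 <= `|k%:~R|.
    rewrite (le_trans (ler_norm _))// normrMn normrM -mulr_natr -mulrA.
    by rewrite ler_piMr// -ler_pdivlMr// div1r.
  have -> : ln (normc z) = 2 * y * ln q^-1.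
    by rewrite /y; field; rewrite gt_eqF.
  rewrite real_normK ?num_real// rmorphXn/= intrD.
  have -> : n%:~R = y - r by rewrite /r; ring.
  rewrite -subr_ge0 (_ : _ - _ = ln q^-1 *
      (p - k%:~R * r *+ 2 + r ^+ 2)); last by field; rewrite gt_eqF.
  by rewrite mulr_ge0 ?(ltW lq0)// addr_ge0 ?sqr_ge0// subr_ge0 (le_trans kr).
exact: esum_theta_weight_lt_pinfty.
Qed.

Theorem theorem2p2 (R : realType) :
  (forall (a : R[i]) (f : R[i] -> R[i]) (A : int -> R[i]),
    (forall z : R[i], z != a -> has_bisum (fun k => A k * (z - a) ^ k) (f z)) ->
    forall alpha q : R, 0 < alpha -> 0 < q < 1 ->
    let c : \bar R := \esum_(k in [set: int])
      (normc (A k) * q `^ (- (`|k%:~R| `^ (alpha + 1))))%:E in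
    (c < +oo)%E ->
    let beta : R := alpha /
      ((alpha + 1) `^ (1 + alpha^-1) * (ln q^-1) `^ alpha^-1) in
    let gamma : R := (alpha + 1) / alpha in
    forall z : R[i], z != a ->
      normc (f z) <= fine c * expR (beta * `|ln (normc (z - a))| `^ gamma))
  /\
  (forall q alpha : R, 0 < q < 1 -> 0 < alpha < 1 ->
    let c_alpha : \bar R := \esum_(k in [set: int])
      (q `^ (k%:~R ^+ 2 - `|k%:~R| `^ (1 + alpha)))%:E in
    forall z : R[i], z != 0 ->
      normc (theta z q) <=
        fine c_alpha *
          (expR (`|ln (normc z)| ^+ 2 / ln q^-1)) `^ alpha^-1).

Proof.
split=> [a f A fA alpha q a0 q01 c coo beta gamma z za|q alpha q01 a01 c z z0].
  by apply: laurent_growth; rewrite ?subr_eq0//; exact: fA.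
have /andP[q0 q1] := q01; have /andP[a0 a1] := a01.
have lq0 : 0 < ln q^-1 by rewrite ln_gt0// invf_gt1.
apply: (le_trans (theta_growth _ _ _ _ q01 a01 z0)).
apply: ler_wpM2l.
  by rewrite fine_ge0// esum_ge0// => k _; rewrite lee_fin powR_ge0.
(* What is left is [1 / (4 l) <= 1 / (alpha l)] with [l = ln q^-1]. *)
rewrite -expRM ler_expR -[leRHS]mulrA -invfM ler_wpM2l ?sqr_ge0//.
rewrite lef_pV2 ?posrE ?mulr_gt0// [leLHS]mulrC ler_pM2r//.
by rewrite (le_trans (ltW a1))// ler1n.
Qed.
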